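(* Let $\mathtt{L}$ be a functional language and let $\mathcal{B}$ be a $\mathrm{q}_\omega$-compact $\mathtt{L}$-algebra. Then for every finitely generated $\mathtt{L}$-algebra $\mathcal{C}$ the following conditions are equivalent: 1) $\mathcal{C}\in\mathbf{Qvar}(\mathcal{B})$, i.e., $\mathrm{Th}_{\mathrm{qi}}(\mathcal{B})\subseteq\mathrm{Th}_{\mathrm{qi}}(\mathcal{C})$; 2) $\mathcal{C}\in\mathbf{Pvar}(\mathcal{B})$; 3) $\mathcal{C}$ embeds into a direct power of $\mathcal{B}$; 4) $\mathcal{C}$ is separated by $\mathcal{B}$; 5') $\mathcal{C}$ is a subdirect product of limit algebras over $\mathcal{B}$; 6) $\mathcal{C}$ is an algebra defined by a complete atomic type in the theory $\mathrm{Th}_{\mathrm{qi}}(\mathcal{B})$ in $\mathtt{L}$; 7) $\mathcal{C}$ is (isomorphic to) the coordinate algebra of an algebraic set over $\mathcal{B}$ defined by a system of equations in the language $\mathtt{L}$. Moreover, if $\mathcal{B}$ is an $\mathtt{L}$-algebra such that for all finitely generated $\mathtt{L}$-algebras $\mathcal{C}$ the conditions above are equivalent, then $\mathcal{B}$ is $\mathrm{q}_\omega$-compact.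
   Context: A functional language $\mathtt{L}$ is a first-order language with function and constant symbols only (and equality); $\mathtt{L}$-structures are called $\mathtt{L}$-algebras. For a finite set of variables $X=\{x_1,\dots,x_n\}$, $\mathcal{T}_{\mathtt{L}}(X)$ is the absolutely free algebra of terms, and $\mathrm{At}_{\mathtt{L}}(X)$ is the set of atomic formulas $(t=s)$ in variables $X$ (equations). A system of equations is a subset $S\subseteq \mathrm{At}_{\mathtt{L}}(X)$; $\mathrm{V}_{\mathcal{B}}(S)\subseteq B^n$ is its solution set in $\mathcal{B}$ (possibly empty); sets of this form are the algebraic sets over $\mathcal{B}$. The radical $\mathrm{Rad}(Y)$ of an algebraic set $Y=\mathrm{V}_{\mathcal{B}}(S)$ is the largest system of equations in $\mathrm{At}_{\mathtt{L}}(X)$ with solution set $Y$, i.e. the set of all $(t=s)\in\mathrm{At}_{\mathtt{L}}(X)$ holding at all points of $Y$; it defines a congruence $\theta_{\mathrm{Rad}(Y)}$ on $\mathcal{T}_{\mathtt{L}}(X)$ ($t_1\sim t_2$ iff $(t_1=t_2)\in\mathrm{Rad}(Y)$), and $\Gamma(Y)=\mathcal{T}_{\mathtt{L}}(X)/\theta_{\mathrm{Rad}(Y)}$ is the coordinate algebra of $Y$. $\mathcal{B}$ is $\mathrm{q}_\omega$-compact if for any finite $X$, any $S\subseteq\mathrm{At}_{\mathtt{L}}(X)$ and any equation $(t_0=s_0)\in\mathrm{At}_{\mathtt{L}}(X)$ with $\mathrm{V}_{\mathcal{B}}(S)\subseteq\mathrm{V}_{\mathcal{B}}(t_0=s_0)$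 there is a finite $S_0\subseteq S$ with $\mathrm{V}_{\mathcal{B}}(S_0)\subseteq\mathrm{V}_{\mathcal{B}}(t_0=s_0)$. $\mathrm{Th}_{\mathrm{qi}}(\mathcal{B})$ is the set of quasi-identities (universal closures of $\bigwedge_{i=1}^k t_i=s_i\to t=s$) true in $\mathcal{B}$; $\mathbf{Qvar}(\mathcal{B})$ is the class of models of $\mathrm{Th}_{\mathrm{qi}}(\mathcal{B})$. $\mathbf{Pvar}(\mathcal{B})$ is the least prevariety (class closed under subalgebras, direct products and isomorphisms) containing $\mathcal{B}$. The direct product over the empty index set is the trivial (one-element) algebra $\mathcal{E}$; in particular a direct power or a subdirect product (of an arbitrary family) may have empty index set. $\mathcal{C}$ is separated by $\mathcal{B}$ if for any $c_1\neq c_2$ in $C$ there is a homomorphism $h\colon\mathcal{C}\to\mathcal{B}$ with $h(c_1)\neq h(c_2)$; by convention the trivial algebra $\mathcal{E}$ is separated by every $\mathcal{B}$. Limit algebras. For a finite functional language $\mathtt{L}_0$ and a finite non-empty set of variables $Y$, a diagram-formula in $\mathtt{L}_0$ in variables $Y$ is a conjunction $\varphi$ of formulas of the forms $F(y_1,\dots,y_k)=y_0$, $c=y_0$, $y=y'$ ($F,c\in\mathtt{L}_0$, variables in $Y$) and their negations such that: $\neg(y=y')$ occurs in $\varphi$ for all distinct $y,y'\in Y$; for each function symbol $F\in\mathtt{L}_0$ and all $y_0,\dots,y_k\in Y$ either $F(y_1,\dots,y_k)=y_0$ or its negation occurs in $\varphi$; for each constant $c\in\mathtt{L}_0$ and $y\in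 Y$ either $c=y$ or its negation occurs in $\varphi$. A direct system of formulas in $\mathtt{L}$ is a triple $\Lambda=(I,\varphi_i,\gamma_{ij})$ where $I$ is a directed partial order; for each $i\in I$, $\varphi_i$ is a consistent diagram-formula in a finite sublanguage $\mathtt{L}_i\subseteq\mathtt{L}$ in variables $X_i$; for $i\le j$, $\gamma_{ij}\colon X_i\to X_j$ are maps with $\gamma_{ii}=\mathrm{id}$ and $\gamma_{jk}\gamma_{ij}=\gamma_{ik}$; for $i\le j$, $\mathtt{L}_i\subseteq\mathtt{L}_j$ and every conjunct of $\varphi_i(\gamma_{ij}(X_i))$ is a conjunct of $\varphi_j$; for each constant $c\in\mathtt{L}$ there are $i\in I$, $x\in X_i$ such that $c=x$ is a conjunct of $\varphi_i$; for each function symbol $F\in\mathtt{L}$ of arity $k$, $i\in I$ and $y_1,\dots,y_k\in X_i$ there are $j\ge i$ and $y_0\in X_j$ such that $F(\gamma_{ij}(y_1),\dots,\gamma_{ij}(y_k))=y_0$ is a conjunct of $\varphi_j$. The limit algebra of $\Lambda$ has as universe the direct limit of the sets $X_i$ along the maps $\gamma_{ij}$, with constants and operations determined by the conjuncts $c=x$ and $F(y_1,\dots,y_k)=y_0$ of the $\varphi_i$. An $\mathtt{L}$-algebra is a limit algebra over $\mathcal{B}$ if it is isomorphic to the limit algebra of a direct system of formulas in which every $\varphi_i$ is satisfiable in $\mathcal{B}$. Complete atomic types. For a theory $T$ in $\mathtt{L}$ and a finite set $X$, an atomic type in $T$ in variables $X$ is a set $p$ of atomic formulas and negations of atomic formulas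 in variables $X$ such that $p\cup T$ is consistent (satisfiable, with the variables $X$ interpreted by elements of a model of $T$); it is complete if it is maximal under inclusion. The algebra defined by a complete atomic type $p$ is $\mathcal{T}_{\mathtt{L}}(X)/\theta_{p}$, where $t_1\sim_{\theta_p}t_2$ iff $(t_1=t_2)\in p$ (up to isomorphism). *)

(* Defs.v *)
From HB Require Import structures.
From mathcomp Require Import all_boot.
From mathcomp Require Import boolp classical_sets functions cardinality.

Set Implicit Arguments.
Unset Strict Implicit.
Unset Printing Implicit Defensive.

Local Open Scope classical_set_scope.
Local Open Scope quotient_scope.

(* Constant symbols are the symbols of arity 0.  The set of symbols is an
   arbitrary, possibly infinite or empty, type. *)
Record language := Language {
  symb :> Type;
  arity : symb -> nat }.

(* As usual for first-order structures, the universe is non-empty. *)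
Record algebra (L : language) := Algebra {
  carrier :> Type;
  op : forall f : L, ('I_(arity f) -> carrier) -> carrier;
  carrier_inhabited : inhabited carrier }.
Arguments op {L} _ f _.

Inductive term (L : language) (X : Type) : Type :=
| Var of X
| App (f : L) of ('I_(arity f) -> term L X).
Arguments Var {L X} _.
Arguments App {L X} f _.

Definition equation (L : language) (X : Type) : Type := (term L X * term L X)%type.

Inductive literal (E : Type) : Type :=
| Pos of E
| Neg of E.

Fixpoint eval (L : language) (X : Type) (A : algebra L) (a : X -> A)
    (t : term L X) : A :=
  match t with
  | Var x => a x
  | App f ts => op A f (fun k => eval a (ts k))
  end.

Definition holds (L : language) (X : Type) (A : algebra L) (a : X -> A)
    (e : equation L X) : Prop :=
  eval a e.1 = eval a e.2.

Definition holds_lit (L : language) (X : Type) (A : algebra L) (a : X -> A)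
    (l : literal (equation L X)) : Prop :=
  match l with
  | Pos e => holds a e
  | Neg e => ~ holds a e
  end.

Fixpoint rename (L : language) (X Y : Type) (g : X -> Y) (t : term L X) : term L Y :=
  match t with
  | Var x => Var (g x)
  | App f ts => App f (fun k => rename g (ts k))
  end.

Definition rename_lit (L : language) (X Y : Type) (g : X -> Y)
    (l : literal (equation L X)) : literal (equation L Y) :=
  match l with
  | Pos e => Pos (rename g e.1, rename g e.2)
  | Neg e => Neg (rename g e.1, rename g e.2)
  end.

Definition is_hom (L : language) (A B : algebra L) (h : A -> B) : Prop :=
  forall (f : L) (a : 'I_(arity f) -> A), h (op A f a) = op B f (fun k => h (a k)).

Definition embeds (L : language) (A B : algebra L) : Prop :=
  exists h : A -> B, is_hom h /\ injective h.

Definition isomorphic (L : language) (A B : algebra L) : Prop :=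
  exists h : A -> B, is_hom h /\ bijective h.

Definition subuniverse (L : language) (A : algebra L) (P : set A) : Prop :=
  forall (f : L) (a : 'I_(arity f) -> A), (forall k, P (a k)) -> P (op A f a).

Definition subalgebra (L : language) (A : algebra L) (P : set A)
    (Pop : subuniverse P) (P0 : P !=set0) : algebra L :=
  @Algebra L {x : A | P x}
    (fun f a => exist P (op A f (fun k => sval (a k)))
                  (Pop f _ (fun k => svalP (a k))))
    (let: ex_intro x Px := P0 in inhabits (exist P x Px)).

Lemma product_inhabited (L : language) (I : Type) (A : I -> algebra L) :
  inhabited (forall i, A i).
Proof.
have inh i : exists _ : A i, True by have [x] := carrier_inhabited (A i); exists x.
by constructor=> i; exact: sval (cid (inh i)).
Qed.

(* For empty I this is the one-element algebra. *)
Definition product_algebra (L : language) (I : Type) (A : I -> algebra L) : algebra L :=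
  @Algebra L (forall i, A i)
    (fun f a i => op (A i) f (fun k => a k i))
    (product_inhabited A).

Definition power_algebra (L : language) (I : Type) (B : algebra L) : algebra L :=
  product_algebra (fun _ : I => B).

Definition subdirect_product (L : language) (C : algebra L) (I : Type)
    (A : I -> algebra L) : Prop :=
  exists h : C -> product_algebra A,
    [/\ is_hom h, injective h & forall i (y : A i), exists c, h c i = y].

Definition finitely_generated (L : language) (C : algebra L) : Prop :=
  exists G : set C, finite_set G /\
    forall P : set C, subuniverse P -> G `<=` P -> P = setT.

Definition separated (L : language) (C B : algebra L) : Prop :=
  forall c1 c2 : C, c1 <> c2 -> exists h : C -> B, is_hom h /\ h c1 <> h c2.

Record congruence (L : language) (A : algebra L) := Congruence {
  congr_rel :> A -> A -> Prop;
  congr_refl : forall x, congr_rel x x;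
  congr_sym : forall x y, congr_rel x y -> congr_rel y x;
  congr_trans : forall x y z, congr_rel x y -> congr_rel y z -> congr_rel x z;
  congr_op : forall (f : L) (a b : 'I_(arity f) -> A),
    (forall k, congr_rel (a k) (b k)) -> congr_rel (op A f a) (op A f b) }.

Section Quotient.
Variables (L : language) (A : algebra L) (theta : congruence A).

Definition congr_bool : rel {classic A} := fun x y => `[< theta x y >].

Lemma congr_bool_refl : reflexive congr_bool.
Proof. by move=> x; apply/asboolP; exact: congr_refl. Qed.

Lemma congr_bool_sym : symmetric congr_bool.
Proof. by move=> x y; apply/asboolP/asboolP => /congr_sym. Qed.

Lemma congr_bool_trans : transitive congr_bool.
Proof.
move=> y x z /asboolP xy /asboolP yz; apply/asboolP.
exact: congr_trans xy yz.
Qed.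

Definition congr_equiv : equiv_rel {classic A} :=
  EquivRel congr_bool congr_bool_refl congr_bool_sym congr_bool_trans.

Lemma quotient_inhabited : inhabited {eq_quot congr_equiv}.
Proof. by have [x] := carrier_inhabited A; exact: inhabits (\pi x). Qed.

Definition quotient_algebra : algebra L :=
  @Algebra L {eq_quot congr_equiv}
    (fun f a => \pi_({eq_quot congr_equiv}) (op A f (fun k => repr (a k))))
    quotient_inhabited.

End Quotient.

(* There are no terms at all if X is empty and L has no constant symbol; the
   term algebra exists in all other cases. *)
Definition term_algebra (L : language) (X : Type) (inhT : inhabited (term L X)) :
    algebra L :=
  @Algebra L (term L X) (fun f ts => App f ts) inhT.

Definition solset (L : language) (X : Type) (B : algebra L)
    (S : set (equation L X)) : set (X -> B) :=
  [set b | forall e, S e -> holds b e].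
Arguments solset {L X} B S.

Definition Rad (L : language) (X : Type) (B : algebra L) (Y : set (X -> B)) :
    set (equation L X) :=
  [set e | forall b, Y b -> holds b e].

Section CoordinateAlgebra.
Variables (L : language) (X : Type) (inhT : inhabited (term L X)).
Variables (B : algebra L) (Y : set (X -> B)).

Definition rad_congruence : congruence (term_algebra inhT).
Proof.
exists (fun t s => Rad Y (t, s)).
- by [].
- by move=> t s ts b Yb; rewrite /holds /= ts.
- by move=> t s r ts sr b Yb; rewrite /holds /= ts// sr.
- move=> f ts ss tss b Yb; rewrite /holds /=; congr (op B f _).
  by apply/funext => k; exact: tss.
Defined.

Definition coordinate_algebra : algebra L := quotient_algebra rad_congruence.

End CoordinateAlgebra.

Definition q_omega_compact (L : language) (B : algebra L) : Prop :=
  forall (X : finType) (S : set (equation L X)) (e : equation L X),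
    solset B S `<=` solset B [set e] ->
    exists S0 : set (equation L X),
      [/\ finite_set S0, S0 `<=` S & solset B S0 `<=` solset B [set e]].

(* The universal closure of /\_(i < k) premise_i -> conclusion; variables are
   taken among x_0, x_1, x_2, ... *)
Record quasi_identity (L : language) := QuasiIdentity {
  qi_size : nat;
  qi_premise : 'I_qi_size -> equation L nat;
  qi_conclusion : equation L nat }.

Definition qi_true (L : language) (A : algebra L) (q : quasi_identity L) : Prop :=
  forall a : nat -> A,
    (forall i, holds a (qi_premise (q := q) i)) -> holds a (qi_conclusion q).

Definition model (L : language) (T : set (quasi_identity L)) (A : algebra L) : Prop :=
  forall q, T q -> qi_true A q.

Definition Th_qi (L : language) (B : algebra L) : set (quasi_identity L) :=
  [set q | qi_true B q].

Definition Qvar (L : language) (B : algebra L) (C : algebra L) : Prop :=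
  model (Th_qi B) C.

Definition prevariety (L : language) (K : algebra L -> Prop) : Prop :=
  [/\ forall (A : algebra L) (P : set A) (Pop : subuniverse P) (P0 : P !=set0),
        K A -> K (subalgebra Pop P0),
      forall (I : Type) (A : I -> algebra L),
        (forall i, K (A i)) -> K (product_algebra A)
    & forall A A' : algebra L, isomorphic A A' -> K A -> K A'].

Definition Pvar (L : language) (B : algebra L) (C : algebra L) : Prop :=
  forall K : algebra L -> Prop, prevariety K -> K B -> K C.

Section AtomicTypes.
Variables (L : language) (T : set (quasi_identity L)) (X : Type).

Definition atomic_type (p : set (literal (equation L X))) : Prop :=
  exists (A : algebra L) (a : X -> A), model T A /\ forall l, p l -> holds_lit a l.

Definition complete_atomic_type (p : set (literal (equation L X))) : Prop :=
  atomic_type p /\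
  forall q : set (literal (equation L X)), atomic_type q -> p `<=` q -> q = p.

Lemma complete_atomic_typeE (p : set (literal (equation L X))) :
  complete_atomic_type p ->
  exists (A : algebra L) (a : X -> A), forall e, p (Pos e) <-> holds a e.
Proof.
move=> [[A [a [TA pa]]] pmax]; exists A, a => e; split; first exact: pa.
suff <- : [set l | holds_lit a l] = p by [].
by apply: pmax => [|l /pa//]; exists A, a.
Qed.

Definition type_congruence (inhT : inhabited (term L X))
    (p : set (literal (equation L X))) (pc : complete_atomic_type p) :
  congruence (term_algebra inhT).
Proof.
exists (fun t s => p (Pos (t, s))); have [A [a pE]] := complete_atomic_typeE pc.
- by move=> t; apply/pE.
- by move=> t s /pE ts; apply/pE; rewrite /holds /= ts.
- by move=> t s r /pE ts /pE sr; apply/pE; rewrite /holds /= ts sr.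
- move=> f ts ss tss; apply/pE; rewrite /holds /=; congr (op A f _).
  by apply/funext => k; apply/(pE (_, _)).
Defined.

Definition type_algebra (inhT : inhabited (term L X))
    (p : set (literal (equation L X))) (pc : complete_atomic_type p) : algebra L :=
  quotient_algebra (type_congruence inhT pc).

End AtomicTypes.

Definition op_eq (L : language) (Y : Type) (F : L) (ys : 'I_(arity F) -> Y)
    (y0 : Y) : equation L Y :=
  (App F (fun k => Var (ys k)), Var y0).

Definition var_eq (L : language) (Y : Type) (y y' : Y) : equation L Y :=
  (Var y, Var y').

Inductive diagram_atom (L : language) (L0 : set L) (Y : Type) : equation L Y -> Prop :=
| diagram_op (F : L) (ys : 'I_(arity F) -> Y) (y0 : Y) :
    L0 F -> diagram_atom L0 (op_eq ys y0)
| diagram_var (y y' : Y) : diagram_atom L0 (var_eq L y y').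

(* A conjunction is given by the set of its conjuncts; for finite L0 and Y
   there are only finitely many possible conjuncts. *)
Definition diagram_formula (L : language) (L0 : set L) (Y : Type)
    (phi : set (literal (equation L Y))) : Prop :=
  [/\ forall e, phi (Pos e) -> diagram_atom L0 e,
      forall e, phi (Neg e) -> diagram_atom L0 e,
      forall y y' : Y, y <> y' -> phi (Neg (var_eq L y y'))
    & forall (F : L) (ys : 'I_(arity F) -> Y) (y0 : Y), L0 F ->
        phi (Pos (op_eq ys y0)) \/ phi (Neg (op_eq ys y0))].

Definition satisfiable_in (L : language) (Y : Type) (A : algebra L)
    (phi : set (literal (equation L Y))) : Prop :=
  exists a : Y -> A, forall l, phi l -> holds_lit a l.

Definition consistent (L : language) (Y : Type)
    (phi : set (literal (equation L Y))) : Prop :=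
  exists A : algebra L, satisfiable_in A phi.

(* The map ds_map i j is relevant only for i <= j.  It may be taken total
   since all the sets ds_var j are non-empty. *)
Record direct_system (L : language) := DirectSystem {
  ds_index : Type;
  ds_le : ds_index -> ds_index -> Prop;
  ds_lang : ds_index -> set L;
  ds_var : ds_index -> finType;
  ds_formula : forall i, set (literal (equation L (ds_var i)));
  ds_map : forall i j, ds_var i -> ds_var j;
  ds_le_refl : forall i, ds_le i i;
  ds_le_anti : forall i j, ds_le i j -> ds_le j i -> i = j;
  ds_le_trans : forall i j k, ds_le i j -> ds_le j k -> ds_le i k;
  ds_index_inhabited : inhabited ds_index;
  ds_directed : forall i j, exists k, ds_le i k /\ ds_le j k;
  ds_lang_finite : forall i, finite_set (ds_lang i);
  ds_var_inhabited : forall i, inhabited (ds_var i);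
  ds_diagram : forall i, diagram_formula (ds_lang i) (@ds_formula i);
  ds_consistent : forall i, consistent (@ds_formula i);
  ds_map_id : forall i x, @ds_map i i x = x;
  ds_map_comp : forall i j k, ds_le i j -> ds_le j k ->
    forall x, @ds_map j k (@ds_map i j x) = @ds_map i k x;
  ds_lang_le : forall i j, ds_le i j -> ds_lang i `<=` ds_lang j;
  ds_formula_le : forall i j, ds_le i j ->
    forall l, ds_formula l -> ds_formula (rename_lit (@ds_map i j) l);
  ds_const : forall c : L, arity c = 0 ->
    exists (i : ds_index) (ys : 'I_(arity c) -> ds_var i) (x : ds_var i),
      ds_formula (Pos (op_eq ys x));
  ds_op : forall F : L, 0 < arity F ->
    forall (i : ds_index) (ys : 'I_(arity F) -> ds_var i),
    exists (j : ds_index) (y0 : ds_var j),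
      ds_le i j /\ ds_formula (Pos (op_eq (fun k => @ds_map i j (ys k)) y0)) }.
Arguments ds_map {L} d i j _.
Arguments ds_formula {L} d i _.

Section LimitAlgebra.
Variables (L : language) (D : direct_system L).
Local Notation I := (ds_index D).
Local Notation "i <=I j" := (@ds_le L D i j) (at level 70).
Local Notation X := (@ds_var L D).
Local Notation gamma := (ds_map D).
Local Notation phi := (ds_formula D).

Definition lim_rel (u v : {i : I & X i}) : Prop :=
  exists k, [/\ tag u <=I k, tag v <=I k
    & gamma (tag u) k (tagged u) = gamma (tag v) k (tagged v)].

Definition lim_bool : rel {classic {i : I & X i}} := fun u v => `[< lim_rel u v >].

Lemma lim_bool_refl : reflexive lim_bool.
Proof. by move=> u; apply/asboolP; exists (tag u); split=> //; exact: ds_le_refl. Qed.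

Lemma lim_bool_sym : symmetric lim_bool.
Proof. by move=> u v; apply/asboolP/asboolP => -[k [? ? ?]]; exists k. Qed.

Lemma lim_bool_trans : transitive lim_bool.
Proof.
move=> v u w /asboolP[k [uk vk euv]] /asboolP[l [vl wl evw]]; apply/asboolP.
have [m [km lm]] := ds_directed k l.
exists m; split; [exact: ds_le_trans km|exact: ds_le_trans lm|].
rewrite -(ds_map_comp uk km) euv (ds_map_comp vk km).
by rewrite -(ds_map_comp vl lm) evw (ds_map_comp wl lm).
Qed.

Definition lim_equiv : equiv_rel {classic {i : I & X i}} :=
  EquivRel lim_bool lim_bool_refl lim_bool_sym lim_bool_trans.

Definition lim_set : Type := {eq_quot lim_equiv}.

Definition to_lim (i : I) (x : X i) : lim_set :=
  \pi_({eq_quot lim_equiv}) (existT X i x).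

Lemma to_limP i (x : X i) j (y : X j) :
  to_lim x = to_lim y <->
  exists k, [/\ i <=I k, j <=I k & gamma i k x = gamma j k y].
Proof.
split=> [/eqmodP/asboolP[k kP]|kP]; first by exists k.
by apply/eqmodP/asboolP; case: kP => k kP; exists k.
Qed.

Lemma to_lim_map i j (x : X i) : i <=I j -> to_lim (gamma i j x) = to_lim x.
Proof.
move=> ij; apply/to_limP; exists j; split=> //; first exact: ds_le_refl.
by rewrite ds_map_id.
Qed.

Lemma to_lim_surj (u : lim_set) : exists i (x : X i), u = to_lim x.
Proof.
exists (tag (repr u)), (tagged (repr u)).
by rewrite -[LHS]reprK /to_lim; case: (repr u).
Qed.

Lemma to_lim_surj_fin n (u : 'I_n -> lim_set) :
  exists i (xs : 'I_n -> X i), forall k, u k = to_lim (xs k).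
Proof.
have ub (s : seq 'I_n) :
    exists i, forall k, k \in s -> exists x : X i, u k = to_lim x.
  elim: s => [|k s [i iP]]; first by have [i] := ds_index_inhabited D; exists i.
  have [j [x ux]] := to_lim_surj (u k).
  have [m [im jm]] := ds_directed i j; exists m => l; rewrite inE => /orP[/eqP->|].
    by exists (gamma j m x); rewrite to_lim_map.
  by move=> /iP[y uy]; exists (gamma i m y); rewrite to_lim_map.
have [i iP] := ub (enum 'I_n).
have xP k : exists x : X i, u k = to_lim x by apply: iP; rewrite mem_enum.
by exists i, (fun k => sval (cid (xP k))) => k; case: cid.
Qed.

Definition lim_graph (F : L) (u : 'I_(arity F) -> lim_set) (v : lim_set) : Prop :=
  exists (i : I) (ys : 'I_(arity F) -> X i) (y0 : X i),
    [/\ phi i (Pos (op_eq ys y0)), forall k, u k = to_lim (ys k) & v = to_lim y0].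

Lemma lim_graph_total (F : L) (u : 'I_(arity F) -> lim_set) :
  exists v, lim_graph u v.
Proof.
have [F0|Fgt0] := posnP (arity F).
  have [i [ys [x cx]]] := ds_const D F0; exists (to_lim x), i, ys, x.
  by split=> // k; exfalso; have := ltn_ord k; rewrite [X in _ < X]F0.
have [i [ys uE]] := to_lim_surj_fin u.
have [j [y0 [ij Fy0]]] := ds_op Fgt0 ys.
exists (to_lim y0), j, (fun k => gamma i j (ys k)), y0; split=> // k.
by rewrite to_lim_map.
Qed.

Lemma lim_graph_fun (F : L) (u : 'I_(arity F) -> lim_set) v v' :
  lim_graph u v -> lim_graph u v' -> v = v'.
Proof.
move=> [i [ys [y0 [iF uE ->]]]] [j [zs [z0 [jF uE' ->]]]].
have ub (s : seq 'I_(arity F)) : exists m, [/\ i <=I m, j <=I m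
    & forall k, k \in s -> gamma i m (ys k) = gamma j m (zs k)].
  elim: s => [|k s [m [im jm mP]]].
    by have [m [im jm]] := ds_directed i j; exists m.
  have /to_limP[l [il jl yz]] : to_lim (ys k) = to_lim (zs k) by rewrite -uE uE'.
  have [n [mn ln]] := ds_directed m l.
  exists n; split; [exact: ds_le_trans mn|exact: ds_le_trans mn|].
  move=> h; rewrite inE => /orP[/eqP->|/mP e].
    by rewrite -(ds_map_comp il ln) yz (ds_map_comp jl ln).
  by rewrite -(ds_map_comp im mn) e (ds_map_comp jm mn).
have [m [im jm mP]] := ub (enum 'I_(arity F)).
apply/to_limP; exists m; split=> //; apply: contrapT => neq.
have [A [a aP]] := ds_consistent (d := D) m.
have [_ _ neqP _] := ds_diagram (d := D) m.
have /aP := neqP _ _ neq; apply.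
have /aP := ds_formula_le im iF; have /aP := ds_formula_le jm jF.
rewrite /= /holds /= => <- <-; congr (op A F _); apply/funext => k /=.
by rewrite mP// mem_enum.
Qed.

Lemma lim_inhabited : inhabited lim_set.
Proof.
have [i] := ds_index_inhabited D; have [x] := ds_var_inhabited (d := D) i.
exact: inhabits (to_lim x).
Qed.

Definition limit_algebra : algebra L :=
  @Algebra L lim_set (fun F u => sval (cid (@lim_graph_total F u))) lim_inhabited.

End LimitAlgebra.

Definition limit_algebra_over (L : language) (B A : algebra L) : Prop :=
  exists D : direct_system L,
     (forall i, satisfiable_in B (ds_formula D i)) /\ isomorphic A (limit_algebra D).

(* Main.v *)
(* Separation by B is the hub of the equivalence.  It is inherited by products
   and subalgebras, hence by Pvar(B), and it implies Qvar(B) for any B.  The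
   converse for a finitely generated member C of Qvar(B) is where
   q_omega-compactness enters: if two generator terms t, s differ in C but agree
   on all solutions in B of the equations true in C, then they already agree on
   the solutions of finitely many of these, which is a quasi-identity true in B
   and false in C.
   Conversely, for a system S in variables X, the equations entailed over B by
   finite parts of S form a congruence on the term algebra whose quotient lies
   in Qvar(B); separation of this quotient by B is exactly compactness for S.
   A subalgebra of B is the limit of the finite diagrams of its elements.  A
   quasi-identity fails in a limit algebra only if it fails in B: finitely many
   terms are evaluated inside a single diagram, which B satisfies. *)
Require Import Defs.
From HB Require Import structures.
From mathcomp Require Import all_boot.
From mathcomp Require Import finmap boolp classical_sets functions cardinality.

Set Implicit Arguments.
Unset Strict Implicit.
Unset Printing Implicit Defensive.

Local Open Scope classical_set_scope.
Local Open Scope quotient_scope.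

(** * Evaluation of terms under homomorphisms and renamings *)

Lemma sval_injective (T : Type) (P : T -> Prop) : injective (@sval T P).
Proof. by move=> [x xP] [y yP] /= xy; exact: eq_exist. Qed.

Lemma eval_hom (L : language) (X : Type) (A B : algebra L) (h : A -> B)
    (a : X -> A) (t : term L X) :
  is_hom h -> h (eval a t) = eval (h \o a) t.
Proof.
move=> hh; elim: t => //= f ts IH.
by rewrite hh; congr op; apply/funext.
Qed.

Lemma eval_rename (L : language) (X Y : Type) (A : algebra L) (g : X -> Y)
    (a : Y -> A) (t : term L X) :
  eval a (rename g t) = eval (a \o g) t.
Proof. by elim: t => //= f ts IH; congr op; apply/funext. Qed.

Lemma hom_holds (L : language) (X : Type) (A B : algebra L) (h : A -> B)
    (a : X -> A) (e : equation L X) :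
  is_hom h -> holds a e -> holds (h \o a) e.
Proof. by move=> hh; rewrite /holds -!(eval_hom _ _ hh) => ->. Qed.

Lemma emb_holds (L : language) (X : Type) (A B : algebra L) (h : A -> B)
    (a : X -> A) (e : equation L X) :
  is_hom h -> injective h -> holds (h \o a) e <-> holds a e.
Proof.
move=> hh hi; split; last exact: hom_holds.
by rewrite /holds -!(eval_hom _ _ hh) => /hi.
Qed.

Lemma is_hom_comp (L : language) (A B C : algebra L) (g : B -> C) (h : A -> B) :
  is_hom g -> is_hom h -> is_hom (g \o h).
Proof. by move=> gg hh f a; rewrite /= hh gg. Qed.

Lemma embeds_refl (L : language) (A : algebra L) : embeds A A.
Proof. by exists id; split=> [f a|]. Qed.

Lemma isomorphic_sym (L : language) (A B : algebra L) :
  isomorphic A B -> isomorphic B A.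
Proof.
move=> [h [hh [g hK gK]]]; exists g; split; last by exists h.
move=> f b; apply: (can_inj hK); rewrite gK hh; congr op.
by apply/funext => k; rewrite gK.
Qed.

(** * Quotient algebras and their universal property *)

Section QuotientTheory.
Variables (L : language) (A : algebra L) (theta : congruence A).

Definition quot_pi (x : A) : quotient_algebra theta :=
  \pi_({eq_quot congr_equiv theta}) x.

Lemma quot_piP (x y : A) : quot_pi x = quot_pi y <-> theta x y.
Proof. by split=> [/eqmodP/asboolP|xy]; last exact/eqmodP/asboolP. Qed.

Lemma quot_pi_surj (u : quotient_algebra theta) : exists x, quot_pi x = u.
Proof. by exists (repr (u : {eq_quot congr_equiv theta})); exact: reprK. Qed.

Lemma quot_pi_hom : is_hom quot_pi.
Proof.
move=> f a; apply/quot_piP; apply: congr_op => k; apply/quot_piP.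
by rewrite {2}/quot_pi reprK.
Qed.

Lemma quot_lift (B : algebra L) (h : A -> B) :
  is_hom h -> (forall x y, theta x y -> h x = h y) ->
  exists g : quotient_algebra theta -> B,
    is_hom g /\ forall x, g (quot_pi x) = h x.
Proof.
move=> hh hE; pose g (u : quotient_algebra theta) :=
  h (repr (u : {eq_quot congr_equiv theta})).
have gE x : g (quot_pi x) = h x by apply: hE; apply/quot_piP; exact: reprK.
exists g; split=> // f a; rewrite [op (quotient_algebra _) _ _]/(quot_pi _).
by rewrite gE hh.
Qed.

Lemma quot_embeds (B : algebra L) (h : A -> B) :
  is_hom h -> (forall x y, theta x y <-> h x = h y) ->
  embeds (quotient_algebra theta) B.
Proof.
move=> hh hE; have [|g [gh gE]] := quot_lift hh; first by move=> x y /hE.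
exists g; split=> // u v; have [x <-] := quot_pi_surj u.
by have [y <-] := quot_pi_surj v; rewrite !gE => /hE/quot_piP.
Qed.

Lemma quot_iso (B : algebra L) (h : A -> B) :
  is_hom h -> (forall x y, theta x y <-> h x = h y) ->
  (forall y, exists x, h x = y) -> isomorphic B (quotient_algebra theta).
Proof.
move=> hh hE hs; apply: isomorphic_sym.
have [|g [gh gE]] := quot_lift hh; first by move=> x y /hE.
exists g; split=> //.
pose k y := quot_pi (sval (cid (hs y))).
have gk : cancel k g by move=> y; rewrite /k gE; case: cid.
exists k => // u; have [x <-] := quot_pi_surj u.
by apply/quot_piP/hE; rewrite gE; case: cid.
Qed.

End QuotientTheory.

(** * Finite generation, separation and prevarieties *)

Lemma fg_presentation (L : language) (C : algebra L) :
  finitely_generated C ->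
  exists (X : finType) (c : X -> C), inhabited (term L X) /\
    forall y, exists t, eval c t = y.
Proof.
move=> [G [finG genG]]; have [x0] := carrier_inhabited C.
have /(finite_seqP (T := {classic C}))[s sG] := finG.
(* Index [size s] lies past the generators and yields the default [x0]: this extra variable makes
   the set of terms non-empty even when [G] is empty and [L] has no constants. *)
pose c (k : 'I_(size s).+1) : C := nth (x0 : {classic C}) s k.
exists 'I_(size s).+1, c; split; first exact: inhabits (Var ord0).
move=> y; suff E : [set y | exists t, eval c t = y] = setT.
  by have /= : [set y | exists t, eval c t = y] y by rewrite E.
apply: genG => [f a aP|x].
  exists (App f (fun k => sval (cid (aP k)))) => /=.
  by congr op; apply/funext => k; case: cid.
rewrite sG /= => xs.
have lt_xs : index (x : {classic C}) s < (size s).+1 by rewrite ltnS index_size.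
by exists (Var (Ordinal lt_xs)); rewrite /= /c /= nth_index.
Qed.

(** If a quasi-identity fails at [a], the sides of its conclusion differ in [C]; a homomorphism
    separating them preserves the premises and so moves the failure into a model of [T]. *)
Lemma separated_model (L : language) (T : set (quasi_identity L))
    (C : algebra L) :
  (forall c1 c2 : C, c1 <> c2 -> exists (A : algebra L) (h : C -> A),
     [/\ model T A, is_hom h & h c1 <> h c2]) ->
  model T C.
Proof.
move=> sep q Tq a prem; apply: contrapT => /sep[A [h [TA hh]]]; apply.
have := TA _ Tq (h \o a) (fun i => hom_holds hh (prem i)).
by rewrite /holds -!eval_hom.
Qed.

Lemma model_Th_qi (L : language) (B : algebra L) : model (Th_qi B) B.
Proof. by []. Qed.

Lemma embeds_model (L : language) (T : set (quasi_identity L))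
    (C A : algebra L) :
  embeds C A -> model T A -> model T C.
Proof.
move=> [h [hh hi]] TA; apply: separated_model => c1 c2 c12.
by exists A, h; split=> // /hi.
Qed.

Lemma iso_embeds (L : language) (A B : algebra L) :
  isomorphic A B -> embeds A B.
Proof. by move=> [h [hh /bij_inj hi]]; exists h. Qed.

Lemma separated_Qvar (L : language) (C B : algebra L) :
  separated C B -> Qvar B C.
Proof.
move=> sep; apply: separated_model => c1 c2 /sep[h [hh hn]].
by exists B, h; split=> //; exact: model_Th_qi.
Qed.

Lemma embeds_separated (L : language) (C D B : algebra L) :
  embeds C D -> separated D B -> separated C B.
Proof.
move=> [g [gg gi]] sep c1 c2 c12.
have [|h [hh hn]] := sep (g c1) (g c2); first by move=> /gi.
by exists (h \o g); split=> //; exact: is_hom_comp.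
Qed.

Lemma power_separated (L : language) (I : Type) (B : algebra L) :
  separated (power_algebra I B) B.
Proof.
move=> c1 c2 c12; suff [i ni] : exists i, c1 i <> c2 i
    by exists (fun c => c i).
by apply/existsNP => c12E; apply: c12; apply/funext.
Qed.

Lemma separated_embeds (L : language) (C B : algebra L) :
  separated C B -> exists I : Type, embeds C (power_algebra I B).
Proof.
(* One coordinate for each homomorphism to [B]. If there is none, separation forces [C] to be
   trivial, which matches the empty power. *)
move=> sep; exists {h : C -> B | is_hom h}, (fun c h => sval h c); split.
  by move=> f a; apply: functional_extensionality_dep => -[h hh] /=; exact: hh.
move=> c1 c2 c12; apply: contrapT => /sep[h [hh]]; apply.
exact: (congr1 (@^~ (exist _ h hh)) c12).
Qed.

Lemma prevariety_separated (L : language) (B : algebra L) :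
  prevariety (fun C => separated C B).
Proof.
split.
- move=> A P Pop P0; apply: embeds_separated; exists sval; split=> //.
  exact: sval_injective.
- move=> I A sepA c1 c2 c12.
  have [i ni] : exists i, c1 i <> c2 i.
    by apply/existsNP => c12E; apply: c12; apply: functional_extensionality_dep.
  have [h [hh hn]] := sepA i _ _ ni; exists (fun c => h (c i)); split=> //.
  by move=> f a; rewrite -hh.
- by move=> A A' /isomorphic_sym/iso_embeds; exact: embeds_separated.
Qed.

Lemma Pvar_separated (L : language) (B C : algebra L) :
  Pvar B C -> separated C B.
Proof.
move=> /(_ (fun D => separated D B)); apply; first exact: prevariety_separated.
by move=> c1 c2 c12; exists id.
Qed.

(** * Homomorphic images as subalgebras *)

Section Image.
Variables (L : language) (A B : algebra L) (h : A -> B) (hh : is_hom h).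

Lemma range_subuniverse : subuniverse (range h).
Proof.
move=> f b bP; exists (op A f (fun k => s2val (cid2 (bP k)))) => //.
by rewrite hh; congr op; apply/funext => k; case: cid2.
Qed.

Lemma range_neq0 : range h !=set0.
Proof. by have [x] := carrier_inhabited A; exists (h x), x. Qed.

Definition image_algebra := subalgebra range_subuniverse range_neq0.

Definition corestriction (x : A) : image_algebra :=
  exist _ (h x) (imageT h x).

Lemma corestriction_hom : is_hom corestriction.
Proof. by move=> f a; apply: sval_injective; rewrite /= hh. Qed.

Lemma corestriction_surj (y : image_algebra) : exists x, corestriction x = y.
Proof. by have [x _ xy] := svalP y; exists x; exact: sval_injective. Qed.

Lemma image_embeds : embeds image_algebra B.
Proof. by exists sval; split=> //; exact: sval_injective. Qed.

Lemma iso_image : injective h -> isomorphic A image_algebra.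
Proof.
move=> hi; exists corestriction; split; first exact: corestriction_hom.
pose g y := sval (cid (corestriction_surj y)).
have gK : cancel g corestriction by move=> y; rewrite /g; case: cid.
exists g => // x; apply: hi.
by have := congr1 sval (gK (corestriction x)).
Qed.

End Image.

Lemma embeds_power_Pvar (L : language) (I : Type) (B C : algebra L) :
  embeds C (power_algebra I B) -> Pvar B C.
Proof.
move=> [h [hh hi]] K [Ksub Kprod Kiso] KB.
apply: Kiso (isomorphic_sym (iso_image hh hi)) _.
by apply: Ksub; apply: Kprod.
Qed.

(** * The finite diagrams of an algebra and their limit *)

Local Open Scope fset_scope.

Section FiniteDiagrams.
Variables (L : language) (A : algebra L) (a0 : A).

(** The first component is the finite sublanguage, the second the set of named elements;
    [{classic _}] supplies the decidable equality that finite sets require. *)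
Definition fd_index : Type := ({fset {classic L}} * {fset {classic A}})%type.

Implicit Types i j : fd_index.

Definition fd_le i j : Prop := (i.1 `<=` j.1) && (i.2 `<=` j.2).

Definition fd_lang i : set L := [set F | F \in i.1].

(* The base point a0 makes every variable set non-empty. *)
Definition fd_var i : finType := (a0 : {classic A}) |` i.2.

Definition fd_val i (x : fd_var i) : A := fsval x.

Definition fd_point i : fd_var i := [` fset1U1 (a0 : {classic A}) i.2].

(** For [i] below [j] this is the inclusion; the default [fd_point j] serves to make the map total
    for other pairs of indices. *)
Definition fd_map i j (x : fd_var i) : fd_var j :=
  insubd (fd_point j) (fsval x).

Definition fd_formula i : set (literal (equation L (fd_var i))) :=
  [set l | match l with
           | Pos e => diagram_atom (fd_lang i) e /\ holds (@fd_val i) e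
           | Neg e => diagram_atom (fd_lang i) e /\ ~ holds (@fd_val i) e
           end].

Lemma fd_val_inj i : injective (@fd_val i).
Proof. exact: val_inj. Qed.

Lemma fd_val_map i j (x : fd_var i) : fd_le i j ->
  fd_val (fd_map j x) = fd_val x.
Proof.
move=> /andP[_ ij]; rewrite /fd_val /fd_map -[LHS]/(val _) insubdK//.
by rewrite [_ \in _](fsubsetP (fsetUS _ ij))// fsvalP.
Qed.

Lemma fd_le_refl i : fd_le i i.
Proof. by rewrite /fd_le !fsubset_refl. Qed.

Lemma fd_le_anti i j : fd_le i j -> fd_le j i -> i = j.
Proof.
case: i j => [F X] [G Y] /andP[/= FG XY] /andP[/= GF YX]; congr pair.
  by apply/eqP; rewrite eqEfsubset FG.
by apply/eqP; rewrite eqEfsubset XY.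
Qed.

Lemma fd_le_trans i j (k : fd_index) : fd_le i j -> fd_le j k -> fd_le i k.
Proof.
move=> /andP[ij1 ij2] /andP[jk1 jk2].
by rewrite /fd_le (fsubset_trans ij1)// (fsubset_trans ij2).
Qed.

Lemma fd_directed i j : exists k, fd_le i k /\ fd_le j k.
Proof.
exists (i.1 `|` j.1, i.2 `|` j.2).
by split; rewrite /fd_le /= ?fsubsetUl ?fsubsetUr.
Qed.

Lemma fd_diagram i : diagram_formula (fd_lang i) (@fd_formula i).
Proof.
split=> [e []//|e []//|y y' yy'|F ys y0 iF].
  by split; [exact: diagram_var|rewrite /holds /= => /fd_val_inj].
have [h|h] := pselect (holds (@fd_val i) (op_eq ys y0)); [left|right];
  by split=> //; exact: diagram_op.
Qed.

(** Embeddings preserve and reflect equations, so negated conjuncts survive in [B] as well. *)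
Lemma fd_satisfiable (B : algebra L) : embeds A B ->
  forall i, satisfiable_in B (@fd_formula i).
Proof.
move=> [h [hh hi]] i; exists (h \o @fd_val i) => -[e|e] [_ /= he].
  exact/emb_holds.
by move=> /(emb_holds _ _ hh hi).
Qed.

Lemma fd_consistent i : consistent (@fd_formula i).
Proof. by exists A; apply: fd_satisfiable; exact: embeds_refl. Qed.

Lemma fd_holds_map i j (e : equation L (fd_var i)) : fd_le i j ->
  holds (@fd_val j) (rename (@fd_map i j) e.1, rename (@fd_map i j) e.2) <->
  holds (@fd_val i) e.
Proof.
move=> ij; rewrite /holds /= !eval_rename.
by have -> : @fd_val j \o @fd_map i j = @fd_val i
  by apply/funext => x; exact: fd_val_map.
Qed.

Lemma fd_atom_map i j (e : equation L (fd_var i)) : fd_le i j ->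
  diagram_atom (fd_lang i) e ->
  diagram_atom (fd_lang j) (rename (@fd_map i j) e.1, rename (@fd_map i j) e.2).
Proof.
move=> /andP[/fsubsetP ij _]; case=> [F ys y0 iF|y y']; last exact: diagram_var.
rewrite -[(_, _)]/(op_eq (fun k => fd_map j (ys k)) (fd_map j y0)).
by apply: diagram_op; exact: ij.
Qed.

Lemma fd_formula_le i j : fd_le i j ->
  forall l, @fd_formula i l -> @fd_formula j (rename_lit (@fd_map i j) l).
Proof.
by move=> ij [e|e] [eD he]; split; [exact: fd_atom_map|exact/fd_holds_map
  |exact: fd_atom_map|move=> /(fd_holds_map _ ij)].
Qed.

Lemma fd_op (F : L) i (ys : 'I_(arity F) -> fd_var i) :
  exists j (y0 : fd_var j),
    fd_le i j /\ fd_formula (Pos (op_eq (fun k => fd_map j (ys k)) y0)).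
Proof.
pose y : {classic A} := op A F (fun k => fd_val (ys k)).
(* Enlarging the index by [F] and by the value [y] makes the required equation a conjunct. *)
pose j : fd_index := ((F : {classic L}) |` i.1, y |` i.2).
have ij : fd_le i j by rewrite /fd_le /= !fsubsetU1.
have yj : y \in (a0 : {classic A}) |` j.2 by rewrite !inE eqxx orbT.
exists j, [` yj]; split=> //; split.
  by apply: diagram_op; rewrite /fd_lang /= !inE eqxx.
rewrite /holds /= -[RHS]/(op A F (fun k => fd_val (ys k))); congr op.
by apply/funext => k; rewrite fd_val_map.
Qed.

Lemma fd_const (c : L) : arity c = 0 ->
  exists i (ys : 'I_(arity c) -> fd_var i) (x : fd_var i),
    fd_formula (Pos (op_eq ys x)).
Proof.
move=> _; have [j [y0 [_ cy0]]] := @fd_op c (fset0, fset0) (fun=> fd_point _).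
by exists j; eexists; exists y0; exact: cy0.
Qed.

Lemma fd_lang_finite i : finite_set (fd_lang i).
Proof. exact: finite_fset i.1. Qed.

Lemma fd_map_id i x : @fd_map i i x = x.
Proof. by apply: fd_val_inj; rewrite fd_val_map//; exact: fd_le_refl. Qed.

Lemma fd_map_comp i j (k : fd_index) : fd_le i j -> fd_le j k ->
  forall x, @fd_map j k (@fd_map i j x) = @fd_map i k x.
Proof.
move=> ij jk x; apply: fd_val_inj; rewrite !fd_val_map//.
exact: fd_le_trans jk.
Qed.

Lemma fd_lang_le i j : fd_le i j -> (fd_lang i `<=` fd_lang j)%classic.
Proof. by move=> /andP[/fsubsetP ij _] F; exact: ij. Qed.

Definition fd_system : direct_system L :=
  @DirectSystem L fd_index fd_le fd_lang fd_var fd_formula fd_map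
    fd_le_refl fd_le_anti fd_le_trans (inhabits (fset0, fset0)) fd_directed
    fd_lang_finite (fun i => inhabits (fd_point i)) fd_diagram fd_consistent
    fd_map_id fd_map_comp fd_lang_le fd_formula_le fd_const
    (fun F _ => @fd_op F).

(** Transition maps do not change the named element, so the limit merely glues the variables that
    name the same element of [A]. *)
Lemma fd_to_lim_inj i (x : fd_var i) j (y : fd_var j) :
  @to_lim L fd_system i x = @to_lim L fd_system j y <-> fd_val x = fd_val y.
Proof.
split=> [/to_limP[k [ik jk]]|xy].
  by move=> /(congr1 (@fd_val k)); rewrite !fd_val_map.
have [k [ik jk]] := fd_directed i j.
apply/to_limP; exists k; split=> //; apply: fd_val_inj.
by rewrite [LHS]fd_val_map// [RHS]fd_val_map.
Qed.

Lemma fd_limit : isomorphic A (limit_algebra fd_system).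
Proof.
pose i1 (x : A) : fd_index := (fset0, [fset (x : {classic A})]).
have xP (x : A) : (x : {classic A}) \in (a0 : {classic A}) |` (i1 x).2.
  by rewrite !inE eqxx orbT.
pose h (x : A) : limit_algebra fd_system := @to_lim L fd_system (i1 x) [` xP x].
have hE i (x : fd_var i) : h (fd_val x) = @to_lim L fd_system i x.
  exact/fd_to_lim_inj.
exists h; split.
  move=> F u; rewrite /=; case: cid => v /= uv.
  apply: lim_graph_fun uv.
  (* This index names all the arguments, so that [fd_op] can start from it. *)
  pose i : fd_index := (fset0, [fset (u k : {classic A}) | k in 'I_(arity F)]).
  have uP k : (u k : {classic A}) \in (a0 : {classic A}) |` i.2.
    by rewrite !inE in_imfset ?orbT.
  have [j [y0 [ij [Fj Fy0]]]] := @fd_op F i (fun k => [` uP k]).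
  exists j, (fun k => fd_map j ([` uP k] : fd_var i)), y0; split=> //.
    by move=> k; apply/fd_to_lim_inj; rewrite fd_val_map.
  apply/fd_to_lim_inj; rewrite -[RHS]Fy0 /=; congr op.
  by apply/funext => k; rewrite fd_val_map.
pose g (v : limit_algebra fd_system) : A :=
  fd_val (tagged (repr (v : {eq_quot lim_equiv fd_system}))).
exists g => [x|v].
  rewrite /g; apply/(@fd_to_lim_inj _ _ _ [` xP x]).
  by rewrite -[RHS](reprK (h x : {eq_quot lim_equiv fd_system})) /to_lim;
    case: (repr _).
rewrite /g hE -[RHS](reprK (v : {eq_quot lim_equiv fd_system})) /to_lim.
by case: (repr _).
Qed.

End FiniteDiagrams.

Local Close Scope fset_scope.

Lemma embeds_limit_algebra (L : language) (A B : algebra L) :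
  embeds A B -> limit_algebra_over B A.
Proof.
move=> AB; have [a0] := carrier_inhabited A.
exists (fd_system a0); split; last exact: fd_limit.
exact: fd_satisfiable.
Qed.

(** Each factor is the image of [C] in one coordinate: a subalgebra of [B], hence a limit algebra
    over [B], onto which [C] projects surjectively. *)
Lemma embeds_power_subdirect (L : language) (I : Type) (B C : algebra L) :
  embeds C (power_algebra I B) ->
  exists (I : Type) (A : I -> algebra L),
    (forall i, limit_algebra_over B (A i)) /\ subdirect_product C A.
Proof.
move=> [h [hh hi]].
have hih i : is_hom (fun c => h c i) by move=> f a; rewrite hh.
exists I, (fun i => image_algebra (hih i)); split.
  by move=> i; apply: embeds_limit_algebra; exact: image_embeds.
exists (fun c i => corestriction (hih i) c); split.
- move=> f a; apply: functional_extensionality_dep => i.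
  exact: corestriction_hom.
- move=> c1 c2 c12; apply: hi; apply: functional_extensionality_dep => i.
  by have /(congr1 sval) := congr1 (fun c => c i) c12.
- by move=> i y; exact: corestriction_surj.
Qed.

(** * Quasi-identities in limit algebras *)

Section LimitModel.
Variables (L : language) (D : direct_system L).
Local Notation I := (ds_index D).
Local Notation "i <=I j" := (@ds_le L D i j) (at level 70).
Local Notation X := (@ds_var L D).
Local Notation gamma := (ds_map D).
Local Notation phi := (ds_formula D).

(** Distinct variables carry a negated equation among the conjuncts; were they identified at a later
    index [k], [phi k] would contain the negation of a trivial equation and be inconsistent. *)
Lemma to_lim_inj (i : I) : injective (@to_lim L D i).
Proof.
move=> x y /to_limP[k [ik _ xyk]]; apply: contrapT => xy.
have [A [a aP]] := ds_consistent (d := D) k.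
have [_ _ neqP _] := ds_diagram (d := D) i.
have /aP := ds_formula_le ik (neqP _ _ xy).
by rewrite /= /holds /= xyk.
Qed.

Lemma limit_opE (F : L) (u : 'I_(arity F) -> limit_algebra D) v :
  lim_graph u v -> op (limit_algebra D) F u = v.
Proof.
by move=> uv; rewrite /=; case: cid => w /= uw; exact: lim_graph_fun uw uv.
Qed.

Lemma ds_upper_bound n (P : 'I_n -> I -> Prop) :
  (forall k i j, i <=I j -> P k i -> P k j) -> (forall k, exists i, P k i) ->
  exists i, forall k, P k i.
Proof.
move=> Ple Pex.
suff ub (s : seq 'I_n) : exists i, forall k, k \in s -> P k i.
  by have [i iP] := ub (enum 'I_n); exists i => k; apply: iP; rewrite mem_enum.
elim: s => [|k s [i iP]]; first by have [i] := ds_index_inhabited D; exists i.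
have [j kj] := Pex k; have [m [im jm]] := ds_directed i j.
exists m => l; rewrite inE => /orP[/eqP->|/iP kPi].
  exact: Ple jm kj.
exact: Ple im kPi.
Qed.

Section Covered.
Variables (V : Type) (a : V -> limit_algebra D).

(* The value of t under a can be computed from the diagram phi i alone. *)
Fixpoint covered (i : I) (t : term L V) : Prop :=
  match t with
  | Var v => exists y : X i, a v = to_lim y
  | App F ts => (forall k, covered i (ts k)) /\
      exists (ys : 'I_(arity F) -> X i) (y0 : X i),
        phi i (Pos (op_eq ys y0)) /\ forall k, eval a (ts k) = to_lim (ys k)
  end.

Lemma covered_le i j t : i <=I j -> covered i t -> covered j t.
Proof.
move=> ij; elim: t => [v [y vy]|F ts IH [cts [ys [y0 [Fy0 tys]]]]] /=.
  by exists (gamma i j y); rewrite vy to_lim_map.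
split=> [k|]; first exact: IH (cts k).
exists (fun k => gamma i j (ys k)), (gamma i j y0); split.
  exact: (ds_formula_le ij Fy0).
by move=> k; rewrite to_lim_map.
Qed.

(** By directedness the finitely many arguments are covered at a common index; going above it and
    above an index recording the value of the operation covers the whole term. *)
Lemma covered_ex t : exists i, covered i t.
Proof.
elim: t => [v|F ts IH] /=; first exact: to_lim_surj.
have [|i ci] := @ds_upper_bound _ (fun k i => covered i (ts k)) _ IH.
  by move=> k i j; exact: covered_le.
have [v [j [ys [y0 [Fy0 tys _]]]]] := lim_graph_total (fun k => eval a (ts k)).
have [m [im jm]] := ds_directed i j; exists m; split.
  by move=> k; exact: covered_le (ci k).
exists (fun k => gamma j m (ys k)), (gamma j m y0); split.
  exact: (ds_formula_le jm Fy0).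
by move=> k; rewrite to_lim_map.
Qed.

Lemma covered_val i t : covered i t -> exists y : X i, eval a t = to_lim y.
Proof.
case: t => [v|F ts] //= [_ [ys [y0 [Fy0 tys]]]]; exists y0.
by apply: limit_opE; exists i, ys, y0.
Qed.

(** The conjuncts [F(ys) = y0] of [phi i] hold in [B] at [b], so evaluation in [B] follows
    evaluation in the limit step by step. *)
Lemma covered_eval (B : algebra L) i (b : X i -> B) (a' : V -> B) t :
  (forall l, phi i l -> holds_lit b l) ->
  (forall v y, a v = to_lim y -> a' v = b y) ->
  covered i t -> forall y, eval a t = to_lim y -> eval a' t = b y.
Proof.
move=> bP a'P; elim: t => [v _|F ts IH ct y ty] /=; first exact: a'P.
have [cts [ys [y0 [Fy0 tys]]]] := ct.
(* Both variables represent the value of the term in the limit. *)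
have -> : y = y0.
  apply: (@to_lim_inj i); rewrite -ty; apply: limit_opE.
  by exists i, ys, y0.
rewrite -[RHS](bP _ Fy0) /=; congr op; apply/funext => k.
exact: IH (cts k) _ (tys k).
Qed.

End Covered.

Lemma limit_model (B : algebra L) :
  (forall i, satisfiable_in B (phi i)) -> Qvar B (limit_algebra D).
Proof.
move=> sat [n prem [t s]] qB a /= aP.
have [i1 c1] := covered_ex a t; have [i2 c2] := covered_ex a s.
pose P (k : 'I_n) i := covered a i (prem k).1 /\ covered a i (prem k).2.
have [||i3 c3] := @ds_upper_bound n P.
- by move=> k i j ij [? ?]; split; apply: covered_le ij _.
- move=> k; have [j1 d1] := covered_ex a (prem k).1.
  have [j2 d2] := covered_ex a (prem k).2.
  have [j [j1j j2j]] := ds_directed j1 j2.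
  by exists j; split; [exact: covered_le d1|exact: covered_le d2].
have [j [i1j i2j]] := ds_directed i1 i2.
(* This [i] lies above all indices chosen so far, so the single diagram [phi i] covers every term of
   the quasi-identity. *)
have [i [ji i3i]] := ds_directed j i3.
have ct : covered a i t by apply: covered_le c1; exact: ds_le_trans ji.
have cs : covered a i s by apply: covered_le c2; exact: ds_le_trans ji.
have cP k : P k i by have [? ?] := c3 k; split; apply: covered_le i3i _.
have [b bP] := sat i; have [b0] := carrier_inhabited B.
(* A variable without a representative at [i] occurs in no covered term; it gets the default
   [b0]. *)
have a'ex v : exists z : B, forall y : X i, a v = to_lim y -> z = b y.
  have [[y vy]|nv] := pselect (exists y : X i, a v = to_lim y).
    by exists (b y) => y'; rewrite vy => /to_lim_inj ->.
  by exists b0 => y vy; case: nv; exists y.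
pose a' v := sval (cid (a'ex v)).
have a'P v (y : X i) : a v = to_lim y -> a' v = b y.
  by rewrite /a'; case: cid => z; exact.
have bE := covered_eval bP a'P.
have [y ty] := covered_val ct; have [z sz] := covered_val cs.
have byz : b y = b z.
  rewrite -(bE _ ct _ ty) -(bE _ cs _ sz); apply: (qB a') => k.
  have [ck1 ck2] := cP k; have [y1 e1] := covered_val ck1.
  rewrite /holds (bE _ ck1 _ e1) (bE _ ck2 y1)//.
  by rewrite -e1; apply/esym; exact: aP.
(* Distinct variables have a negated equation among the conjuncts, so [b] is injective and the
   equality in [B] pulls back to the limit. *)
rewrite /holds /= ty sz; congr to_lim; apply: contrapT => yz.
have [_ _ neqP _] := ds_diagram (d := D) i.
by have /bP := neqP _ _ yz.
Qed.

End LimitModel.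

(** The coordinates of a subdirect product separate points, and each factor is a model of
    [Th_qi B]. *)
Lemma limit_subdirect_Qvar (L : language) (B C : algebra L) (I : Type)
    (A : I -> algebra L) :
  (forall i, limit_algebra_over B (A i)) -> subdirect_product C A -> Qvar B C.
Proof.
move=> limA [h [hh hi _]]; apply: separated_model => c1 c2 c12.
have [i ni] : exists i, h c1 i <> h c2 i.
  apply/existsNP => hE; apply/c12/hi.
  exact: functional_extensionality_dep.
exists (A i), (fun c => h c i); split=> //; last by move=> f a; rewrite hh.
have [D [satD isoD]] := limA i.
exact: embeds_model (iso_embeds isoD) (limit_model satD).
Qed.

(** * Compactness and separation of finitely generated algebras *)

Lemma generated_lift (L : language) (X : Type) (C B : algebra L)
    (c : X -> C) (b : X -> B) :
  (forall y, exists t, eval c t = y) ->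
  (forall t s, eval c t = eval c s -> eval b t = eval b s) ->
  exists h : C -> B, is_hom h /\ forall t, h (eval c t) = eval b t.
Proof.
(* Each element is sent to the value of a chosen term representing it; by [cb] the choice does not
   matter. *)
move=> cgen cb; pose h y := eval b (sval (cid (cgen y))).
have hE t : h (eval c t) = eval b t by apply: cb; case: cid.
exists h; split=> // f a.
pose ts k := sval (cid (cgen (a k))).
have -> : a = fun k => eval c (ts k).
  by apply/funext => k; rewrite /ts; case: cid.
rewrite (hE (App f ts)) /=; congr op; apply/funext => k.
by rewrite hE.
Qed.

(** Quasi-identities use variables indexed by [nat]; [pickle] codes the variables of [X] injectively
    by natural numbers. *)
Definition finite_qi (L : language) (X : finType) n
    (prem : 'I_n -> equation L X) (e : equation L X) : quasi_identity L :=
  let ren (e : equation L X) :=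
    (rename choice.pickle e.1, rename choice.pickle e.2) in
  QuasiIdentity (fun k => ren (prem k)) (ren e).

Lemma finite_qiP (L : language) (X : finType) (A : algebra L) n
    (prem : 'I_n -> equation L X) (e : equation L X) :
  qi_true A (finite_qi prem e) <->
  forall a : X -> A, (forall k, holds a (prem k)) -> holds a e.
Proof.
have renE (a : nat -> A) (e' : equation L X) :
    holds a (rename choice.pickle e'.1, rename choice.pickle e'.2) =
    holds (a \o choice.pickle) e'.
  by rewrite /holds /= !eval_rename.
split=> [qA a aP|eA a aP]; last first.
  by rewrite renE; apply: eA => k; rewrite -renE; exact: aP.
have [x0] := carrier_inhabited A.
(* Numbers that code no variable receive the default [x0]. *)
pose a' n := if choice.unpickle n is Some x then a x else x0.
have aE : a' \o choice.pickle = a.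
  by apply/funext => x; rewrite /= /a' choice.pickleK.
have := qA a'; rewrite /= renE aE; apply=> k.
by rewrite renE aE.
Qed.

Lemma Qvar_separated (L : language) (B C : algebra L) :
  q_omega_compact B -> finitely_generated C -> Qvar B C -> separated C B.
Proof.
move=> qwB /fg_presentation[X [c [_ cgen]]] QC c1 c2.
have [t <-] := cgen c1; have [s <-] := cgen c2 => ts.
pose S := [set e : equation L X | holds c e].
(* Such a point satisfies every equation true at the generators, hence extends to the separating
   homomorphism. *)
have [b [bS bts]] : exists b : X -> B, solset B S b /\ ~ holds b (t, s).
  apply: contrapT => nb; have [b bS e ->|S0 [finS0 S0S S0ts]] := qwB X S (t, s).
    by apply: contrapT => bts; apply: nb; exists b.
  have /(finite_seqP (T := {classic equation L X}))[r S0E] := finS0.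
  (* The system [S0], enumerated as [r], supplies the premises of a quasi-identity true in [B]; they
     all hold in [C] at [c], which would force [t] and [s] to agree there. *)
  have /QC/finite_qiP cts : Th_qi B (finite_qi (tnth (in_tuple r)) (t, s)).
    apply/finite_qiP => b br; apply: S0ts => // e.
    by rewrite S0E => /(tnthP (in_tuple r))[k ->].
  apply: ts; apply: (cts c) => k.
  by apply: S0S; rewrite S0E /= mem_tnth.
have [|h [hh hE]] := generated_lift (b := b) cgen.
  by move=> t' s' ts'; exact: (bS (t', s')).
by exists h; rewrite !hE.
Qed.

(** * Complete atomic types and coordinate algebras *)

Lemma complete_atomic_type_model (L : language) (T : set (quasi_identity L))
    (X : Type) (A : algebra L) (a : X -> A) :
  model T A -> complete_atomic_type T [set l | holds_lit a l].
Proof.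
move=> TA; split; first by exists A, a.
(* Every equation is decided at [a], so a literal of [q] false at [a] would sit in [q] beside its
   own negation. *)
move=> q [A' [a' [_ qP]]] aq; apply/seteqP; split=> // -[e|e] qe /=.
  by apply: contrapT => ne; have /qP := aq (Neg e) ne; apply; exact: qP _ qe.
by move=> he; apply: (qP _ qe); exact: qP _ (aq (Pos e) he).
Qed.

(** By maximality [p] consists of all literals true at a tuple [a] in a model, and the type algebra
    embeds in that model as the subalgebra generated by [a]. *)
Lemma type_algebra_model (L : language) (T : set (quasi_identity L))
    (X : Type) (inhT : inhabited (term L X))
    (p : set (literal (equation L X))) (pc : complete_atomic_type T p) :
  model T (type_algebra inhT pc).
Proof.
have [[A [a [TA pa]]] pmax] := pc; apply: embeds_model (TA).
have pE : [set l | holds_lit a l] = p.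
  by apply: pmax => [|l /pa//]; exists A, a.
apply: (@quot_embeds _ _ (type_congruence inhT pc) _ (eval a)) => // t s.
have := congr1 (fun q => q (Pos (t, s))) pE; rewrite /= /holds /= => ->.
by [].
Qed.

(** The type is that of the generating tuple in [C], which is itself a model of [Th_qi B]. *)
Lemma Qvar_type_algebra (L : language) (B C : algebra L) :
  finitely_generated C -> Qvar B C ->
  exists (X : finType) (inhT : inhabited (term L X))
      (p : set (literal (equation L X)))
      (pc : complete_atomic_type (Th_qi B) p),
    isomorphic C (type_algebra inhT pc).
Proof.
move=> /fg_presentation[X [c [inhT cgen]]] QC.
exists X, inhT, _, (complete_atomic_type_model c QC).
exact: (@quot_iso _ (term_algebra inhT) _ _ (eval c)).
Qed.

(** An equation outside the radical fails at a point of [Y], and evaluation at this point factors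
    through the quotient. *)
Lemma coordinate_algebra_separated (L : language) (X : Type)
    (inhT : inhabited (term L X)) (B : algebra L) (Y : set (X -> B)) :
  separated (coordinate_algebra inhT Y) B.
Proof.
move=> u v; have [t <-] := quot_pi_surj u; have [s <-] := quot_pi_surj v.
move=> ts; have [b [Yb bts]] : exists b, Y b /\ ~ holds b (t, s).
  apply: contrapT => nb; apply: ts; apply/quot_piP => b Yb.
  by apply: contrapT => bts; apply: nb; exists b.
have [||h [hh hE]] := quot_lift (theta := rad_congruence inhT Y) (h := eval b).
- by [].
- by move=> x y /(_ b Yb).
by exists h; rewrite !hE.
Qed.

(** The system consists of all equations true at the generators. The radical is no larger: a
    homomorphism to [B] refuting an equation sends the generators to a solution of the system. *)
Lemma separated_coordinate_algebra (L : language) (B C : algebra L) :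
  finitely_generated C -> separated C B ->
  exists (X : finType) (inhT : inhabited (term L X)) (S : set (equation L X)),
    isomorphic C (coordinate_algebra inhT (solset B S)).
Proof.
move=> /fg_presentation[X [c [inhT cgen]]] sep.
exists X, inhT, [set e | holds c e].
apply: (@quot_iso _ (term_algebra inhT) _ _ (eval c)) => // t s.
split=> [ts|ts b]; last exact.
apply: contrapT => /sep[h [hh]]; apply; rewrite !eval_hom//.
by apply: ts => e ce; exact: hom_holds.
Qed.

(** * Finite entailment and the converse direction *)

Section FinitelyEntailed.
Variables (L : language) (X : finType) (inhT : inhabited (term L X)).
Variables (B : algebra L) (S : set (equation L X)).

Definition finitely_entailed (e : equation L X) : Prop :=
  exists S0 : set (equation L X),
    [/\ finite_set S0, S0 `<=` S & solset B S0 `<=` solset B [set e]].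

(** The union of finitely many finite subsystems is finite. Both the congruence laws and the
    quasi-identities of [B] are inferences of this form. *)
Lemma finitely_entailed_ind n (prem : 'I_n -> equation L X) (e : equation L X) :
  (forall k, finitely_entailed (prem k)) ->
  (forall b : X -> B, (forall k, holds b (prem k)) -> holds b e) ->
  finitely_entailed e.
Proof.
move=> premP eP; pose S0 k := sval (cid (premP k)).
have S0P k : [/\ finite_set (S0 k), S0 k `<=` S
    & solset B (S0 k) `<=` solset B [set prem k]].
  by rewrite /S0; case: cid.
exists (\bigcup_k S0 k); split.
- by apply: bigcup_finite => // k _; case: (S0P k).
- by move=> d [k _]; case: (S0P k) => _ + _; exact.
- move=> b bS _ ->; apply: eP => k; have [_ _ kP] := S0P k.
  by apply: (kP b) => // d dk; apply: bS; exists k.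
Qed.

Lemma finitely_entailed_mem e : S e -> finitely_entailed e.
Proof. by move=> Se; exists [set e]; split=> // _ ->. Qed.

Definition entailment_congruence : congruence (term_algebra inhT).
Proof.
exists (fun t s => finitely_entailed (t, s)).
- by move=> t; apply: (@finitely_entailed_ind 0 (fun=> (t, t))) => // -[].
- move=> t s ts.
  by apply: (@finitely_entailed_ind 1 (fun=> (t, s))) => // b /(_ ord0).
- move=> t s r ts sr.
  apply: (@finitely_entailed_ind 2
    (fun k => if k == ord0 then (t, s) else (s, r))) => [k|b bP].
    by case: ifP.
  by rewrite /holds /= (bP ord0); exact: (bP ord_max).
- move=> f ts ss tss.
  apply: (finitely_entailed_ind (prem := fun k => (ts k, ss k))) => // b bP.
  by rewrite /holds /=; congr op; apply/funext => k; exact: bP.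
Defined.

Local Notation entailment_algebra := (quotient_algebra entailment_congruence).

Lemma entailment_eqP t s :
  quot_pi entailment_congruence t = quot_pi entailment_congruence s <->
  finitely_entailed (t, s).
Proof. exact: quot_piP. Qed.

Definition generic_point (x : X) : entailment_algebra :=
  quot_pi entailment_congruence (Var x).

Lemma eval_generic_point t :
  eval generic_point t = quot_pi entailment_congruence t.
Proof.
have := @eval_hom _ _ (term_algebra inhT) _ _ Var t
  (@quot_pi_hom _ _ entailment_congruence).
move=> <-; congr quot_pi; elim: t => //= f ts IH; congr App; exact/funext.
Qed.

Lemma entailment_algebra_fg : finitely_generated entailment_algebra.
Proof.
exists (range generic_point); split; first exact: finite_image.
move=> P Pop XP; apply/seteqP; split=> // u _.
have [t <-] := quot_pi_surj u; rewrite -eval_generic_point.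
elim: t => [x|f ts IH] /=; first by apply: XP; exists x.
exact: Pop.
Qed.

Lemma entailment_algebra_Qvar : Qvar B entailment_algebra.
Proof.
move=> [n prem [t s]] qB a aP.
(* Lifting the assignment to terms gives a substitution [sg]: the premises become finitely entailed
   equations, and each point [b] of [B] turns [sg] into an assignment in [B]. *)
pose sg x : term_algebra inhT := sval (cid (quot_pi_surj (a x))).
have evE r : eval a r = quot_pi entailment_congruence (eval sg r).
  rewrite eval_hom; last exact: quot_pi_hom.
  by congr eval; apply/funext => x; rewrite /= /sg; case: cid.
rewrite /holds /= !evE; apply/entailment_eqP.
apply: (finitely_entailed_ind
  (prem := fun k => (eval sg (prem k).1, eval sg (prem k).2))) => [k|b bP].
  by apply/entailment_eqP; rewrite -!evE; exact: aP.
have sgE r : eval b (eval sg r) = eval (fun x => eval b (sg x)) r.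
  exact: (eval_hom (h := eval b : term_algebra inhT -> B)).
rewrite /holds /= !sgE; apply: qB => k /=.
by rewrite /holds -!sgE; exact: bP.
Qed.

(** A homomorphism to [B] maps the generic point to a solution of [S], which satisfies the entailed
    equation; hence no homomorphism separates the two classes. *)
Lemma entailment_algebra_separated t s :
  separated entailment_algebra B ->
  solset B S `<=` solset B [set (t, s)] -> finitely_entailed (t, s).
Proof.
move=> sep Sts; suff: eval generic_point t = eval generic_point s.
  by rewrite !eval_generic_point => /entailment_eqP.
apply: contrapT => /sep[h [hh]]; apply; rewrite !eval_hom//.
have Sh : solset B S (h \o generic_point).
  move=> [t' s'] Se; apply: hom_holds => //; rewrite /holds !eval_generic_point.
  exact/entailment_eqP/finitely_entailed_mem.
exact: (Sts _ Sh (t, s)).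
Qed.

End FinitelyEntailed.

Theorem theorem3p7 (L : language) (B : algebra L) :
  let conditions_equivalent (C : algebra L) :=
    [<-> (* 1 *) Qvar B C;
         (* 2 *) Pvar B C;
         (* 3 *) exists I : Type, embeds C (power_algebra I B);
         (* 4 *) separated C B;
         (* 5' *) exists (I : Type) (A : I -> algebra L),
           (forall i, limit_algebra_over B (A i)) /\ subdirect_product C A;
         (* 6 *) exists (X : finType) (inhT : inhabited (term L X))
             (p : set (literal (equation L X)))
             (pc : complete_atomic_type (Th_qi B) p),
           isomorphic C (type_algebra inhT pc);
         (* 7 *) exists (X : finType) (inhT : inhabited (term L X))
             (S : set (equation L X)),
           isomorphic C (coordinate_algebra inhT (solset B S))] in
  (q_omega_compact B ->
   forall C : algebra L, finitely_generated C -> conditions_equivalent C) /\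
  ((forall C : algebra L, finitely_generated C -> conditions_equivalent C) ->
   q_omega_compact B).
Proof.
move=> cond; split=> [qwB C fgC|eqv X S [t s] Sts].
(* Compactness enters the cycle through [Qsep], in the steps from 1 to 2 and from 6 to 7. *)
- have Qsep : Qvar B C -> separated C B by exact: Qvar_separated.
  rewrite /cond; tfae.
  + by move=> /Qsep/separated_embeds[I]; exact: embeds_power_Pvar.
  + by move=> /Pvar_separated; exact: separated_embeds.
  + by move=> [I CI]; apply: embeds_separated CI _; exact: power_separated.
  + by move=> /separated_embeds[I]; exact: embeds_power_subdirect.
  + move=> [I [A [limA subA]]]; apply: Qvar_type_algebra => //.
    exact: limit_subdirect_Qvar subA.
  + move=> [X [inhT [p [pc isoC]]]]; apply: separated_coordinate_algebra => //.
    apply: Qsep; apply: embeds_model (iso_embeds isoC) _.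
    exact: type_algebra_model.
  + move=> [X [inhT [S isoC]]]; apply: separated_Qvar.
    apply: embeds_separated (iso_embeds isoC) _.
    exact: coordinate_algebra_separated.
(* The equation itself provides a term, even if [X] is empty and [L] has no constants. *)
- have inhT : inhabited (term L X) by exact: inhabits t.
  apply: (entailment_algebra_separated (inhT := inhT)) => //.
  have := eqv _ (entailment_algebra_fg inhT B S).
  (* Entries 0 and 3, counted from zero, are conditions 1 and 4. *)
  rewrite /cond => /(_ 0 3)[+ _]; apply; exact: entailment_algebra_Qvar.
Qed.
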